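(* Let $d\geqslant 2$ be an even integer and $a,e$ indeterminates. Let $n$ be a positive integer with $n\equiv d+1\pmod{2d}$. Let $M=(n-1)/2$ if $d=2$, and $M=(dn-n+1)/(2d)$ otherwise. Then, modulo $\Phi_{n}(q)(1-aq^n)(a-q^n)$, \[ \sum_{k=0}^{M}[3dk-1]\frac{(q^{-1},e,q^{d-1}/e; q^{2d})_{k}\,(aq,q/a,q^{d-3};q^{d})_{k}\, q^{dk} } {(q^{d},e,q^{d-1}/e;q^{d})_{k}\,(aq^{2d-2}, q^{2d-2}/a,q^{d+2};q^{2 d})_{k} } \equiv 0. \]
   Context: For an expression $x$ and a base $p$, $(x;p)_k=(1-x)(1-xp)\cdots(1-xp^{k-1})$ (with $(x;p)_0=1$), and $(x_1,\dots,x_m;p)_k=(x_1;p)_k\cdots(x_m;p)_k$. The $q$-integer is $[m]=(1-q^m)/(1-q)$ for any integer $m$. $\Phi_n(q)$ denotes the $n$-th cyclotomic polynomial in $q$. Two rational functions $A,B$ in $q,a,e$ are congruent modulo a polynomial $P$ if $P$ divides the numerator of the reduced form of $A-B$ in the polynomial ring over $\mathbb{Z}$ (the denominators being coprime to $P$). *)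

(* Defs.v *)
From HB Require Import structures.
From mathcomp Require Import all_boot all_order all_algebra all_field.

Set Implicit Arguments.
Unset Strict Implicit.
Unset Printing Implicit Defensive.

Import GRing.Theory.
Local Open Scope ring_scope.

Notation "x %:F" := (@FracField.tofrac _ x) : ring_scope.

(* Ring divisibility: [%|] of polydiv is pseudo-divisibility, which ignores
   constant factors of the coefficient ring and is thus too weak over Z. *)
Definition divides (R : comNzRingType) (x y : R) : Prop :=
  exists z : R, y = z * x.

Definition coprime_elts (R : comUnitRingType) (x y : R) : Prop :=
  forall g : R, divides g x -> divides g y -> g \is a GRing.unit.

(* N / D is the reduced form of A - B, unique up to a unit when R is
   factorial. The last condition is the usual proviso on denominators; it also
   follows from the two before it. *)
Definition frac_congr (R : idomainType) (P : R) (A B : {fraction R}) : Prop :=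
  exists N D : R,
    [/\ D != 0,
        A - B = N%:F / D%:F,
        coprime_elts N D,
        divides P N
      & coprime_elts D P].

(* (x; p)_k *)
Definition qpoch (K : comNzRingType) (x p : K) (k : nat) : K :=
  \prod_(i < k) (1 - x * p ^+ i).

(* (x_1, ..., x_m; p)_k *)
Definition qpochs (K : comNzRingType) (xs : seq K) (p : K) (k : nat) : K :=
  \prod_(x <- xs) qpoch x p k.

Definition qint (K : fieldType) (q : K) (m : int) : K :=
  (1 - q ^ m) / (1 - q).

(* Z[q, a, e], as Z[q][a][e]. *)
Notation Zqae := {poly {poly {poly int}}}.

Definition vq : Zqae := 'X%:P%:P.
Definition va : Zqae := 'X%:P.
Definition ve : Zqae := 'X.

Definition modulus (n : nat) : Zqae :=
  ('Phi_n)%:P%:P * (1 - va * vq ^+ n) * (va - vq ^+ n).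

(* Exponents that can be negative for some d or k are integers. *)
Definition summand (K : fieldType) (q a e : K) (d k : nat) : K :=
  qint q ((3 * d * k)%N%:Z - 1)
  * (qpochs [:: q^-1; e; q ^+ (d - 1) / e] (q ^+ (2 * d)) k
     * qpochs [:: a * q; q / a; q ^ (d%:Z - 3)] (q ^+ d) k
     * q ^+ (d * k))
  / (qpochs [:: q ^+ d; e; q ^+ (d - 1) / e] (q ^+ d) k
     * qpochs [:: a * q ^+ (2 * d - 2); q ^+ (2 * d - 2) / a; q ^+ (d + 2)]
         (q ^+ (2 * d)) k).

(* For d even and n = d + 1 mod 2d both quotients are exact. *)
Definition upper (d n : nat) : nat :=
  (if d == 2 then (n - 1) %/ 2 else (d * n - n + 1) %/ (2 * d))%N.

(* Main.v *)
Require Import Defs.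
From HB Require Import structures.
From mathcomp Require Import all_boot all_order all_algebra all_field.
From mathcomp Require Import ring zify.
From Stdlib Require Import Classical_Prop.

(** With p = q^d, b = aq, c = q/a and q^-1 in the role of the first parameter,
    the sum is, up to the factor 1/(1-q), a sum over k of terms with the e-part
    (e, p/(qe); p^2)_k / (e, p/(qe); p)_k.  Expanding this quotient as a
    terminating p^2-series in j and exchanging the two sums leaves, for each j,
    a quadratic sum without e whose first parameter is multiplied by p^(6j) and
    whose parameters b and c are multiplied by p^(2j).  These quadratic sums
    vanish when the first parameter is p^(-2N), or when b or c is an odd
    negative power of p, by telescoping relations that shift the first parameter
    (resp. b) by p^2.

    The first case occurs when q is a primitive n-th root of unity, the second
    when a = q^n or a = q^(-n).  The corresponding evaluations of Z[q,a,e] have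
    the prime kernels generated by Phi_n(q), a - q^n and 1 - a q^n; as the sum is
    defined and zero at all three, each generator divides the reduced numerator. *)

Set Implicit Arguments.
Unset Strict Implicit.
Unset Printing Implicit Defensive.

Import GRing.Theory.
Local Open Scope ring_scope.

(** * q-Pochhammer symbols *)

Section QPoch.
Variable K : comNzRingType.
Implicit Types (x p : K) (k m : nat).

Lemma qpoch0 x p : qpoch x p 0 = 1.
Proof. by rewrite /qpoch big_ord0. Qed.

Lemma qpochS x p k : qpoch x p k.+1 = qpoch x p k * (1 - x * p ^+ k).
Proof. by rewrite /qpoch big_ord_recr. Qed.

Lemma qpochD x p m k : qpoch x p (m + k) = qpoch x p m * qpoch (x * p ^+ m) p k.
Proof.
elim: k => [|k IHk]; first by rewrite addn0 qpoch0 mulr1.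
by rewrite addnS !qpochS IHk exprD !mulrA.
Qed.

Lemma qpochSl x p k : qpoch x p k.+1 = (1 - x) * qpoch (x * p) p k.
Proof. by rewrite -add1n qpochD qpochS qpoch0 expr0 expr1 mul1r mulr1. Qed.

Lemma qpoch_eq0 x p i k : (i < k)%N -> x * p ^+ i = 1 -> qpoch x p k = 0.
Proof.
by move=> ltik xi; rewrite /qpoch (bigD1 (Ordinal ltik)) //= xi subrr mul0r.
Qed.

End QPoch.

Lemma qpoch_neq0 (K : idomainType) (x p : K) k :
  (forall i, (i < k)%N -> x * p ^+ i != 1) -> qpoch x p k != 0.
Proof.
move=> nz; apply/prodf_neq0 => i _.
by rewrite subr_eq0 eq_sym nz.
Qed.

Lemma qpoch_neq0W (K : idomainType) (x p : K) m k :
  (m <= k)%N -> qpoch x p k != 0 -> qpoch x p m != 0.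
Proof. by move=> /subnKC <-; rewrite qpochD mulf_eq0 negb_or => /andP[]. Qed.

(** * Quadratic sums without e: telescoping and vanishing *)

Section QuadraticSum.
Variable K : fieldType.
Implicit Types a b c p : K.

(* [split_summand] below with its quotient of e-factors replaced by p^C(i, 2). *)
Definition quad_term a b c p (i : nat) : K :=
  (1 - a * p ^+ (3 * i))
  * (qpoch a (p ^+ 2) i * qpoch b p i * qpoch c p i * qpoch (a * p / (b * c)) p i)
  * p ^+ 'C(i.+1, 2)
  / (qpoch p p i * (qpoch (a * p ^+ 2 / b) (p ^+ 2) i
     * qpoch (a * p ^+ 2 / c) (p ^+ 2) i * qpoch (b * c * p) (p ^+ 2) i)).

Lemma quad_term0 a b c p : quad_term a b c p 0 = 1 - a.
Proof. by rewrite /quad_term !qpoch0 muln0 /= !(mulr1, divr1, expr0). Qed.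

Lemma expr_bin2SS p (i : nat) : p ^+ 'C(i.+2, 2) = p ^+ 'C(i.+1, 2) * (p ^+ i * p).
Proof. by rewrite binS bin1 exprD exprSr. Qed.

Lemma subr_div_neq0 x b : b != 0 -> 1 - x / b != 0 -> b - x != 0.
Proof. by move=> b0; apply: contra_neq => /subr0_eq <-; rewrite divff ?subrr. Qed.

Lemma subr_divM_neq0 x b s t : b != 0 -> 1 - x / b * s * t != 0 -> b - x * s * t != 0.
Proof.
by move=> b0; have -> : x / b * s * t = x * s * t / b; [ring | apply: subr_div_neq0].
Qed.

(** Shaped after the body of [quad_term]: the prefactor v is brought next to the symbol t that it
    extends. *)
Fact mulr_absorb (u v x w t y z : K) :
  u * v * (x * (w * t) * y / z) = u * (x * (w * (v * t)) * y / z).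
Proof. by ring. Qed.

Fact mulr_absorb2 (u v x w t w' w'' y z : K) :
  u * v * (x * (w * t * w' * w'') * y / z) = u * (x * (w * (v * t) * w' * w'') * y / z).
Proof. by ring. Qed.

(** Telescoping, by induction on L. The right-hand side contains (a p^2; p^2)_L, so it vanishes when
    a = p^(-2N) with 1 <= N <= L; what remains relates the sums for a and a p^2. *)
Lemma quad_sum_shift_a a b c p (L : nat) :
    p != 0 -> b != 0 -> c != 0 ->
    qpoch p p L != 0 -> qpoch (b * c * p) (p ^+ 2) L != 0 ->
    qpoch (a * p ^+ 2 / b) (p ^+ 2) L.+1 != 0 ->
    qpoch (a * p ^+ 2 / c) (p ^+ 2) L.+1 != 0 ->
  \sum_(i < L.+1) ((1 - a * p ^+ 2 / b) * (1 - a * p ^+ 2 / c) * quad_term a b c p i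
     - (1 - a) * (1 - a * p ^+ 2 / (b * c)) * quad_term (a * p ^+ 2) b c p i)
  = (1 - a) * (a * p ^+ 2 / (b * c))
    * (qpoch (a * p ^+ 2) (p ^+ 2) L * qpoch b p L.+1 * qpoch c p L.+1
       * qpoch (a * p ^+ 2 / (b * c)) p L * p ^+ ('C(L.+1, 2) + L))
    / (qpoch p p L * (qpoch (a * p ^+ 2 / b * p ^+ 2) (p ^+ 2) L
       * qpoch (a * p ^+ 2 / c * p ^+ 2) (p ^+ 2) L * qpoch (b * c * p) (p ^+ 2) L)).
Proof.
move=> p0 b0 c0; elim: L => [|L IHL].
  move=> _ _; rewrite big_ord_recr big_ord0 /= !quad_term0 !qpochS !qpoch0 => _ _.
  by rewrite !expr0 !mulr1 divr1; field; rewrite b0 c0.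
move=> hp hbc hab hac; rewrite big_ord_recr /= IHL; last first.
- exact: qpoch_neq0W hac.
- exact: qpoch_neq0W hab.
- exact: qpoch_neq0W hbc.
- exact: qpoch_neq0W hp.
have [a2b a2c a2bc] : [/\ a * p ^+ 2 * p ^+ 2 / b = a * p ^+ 2 / b * p ^+ 2,
    a * p ^+ 2 * p ^+ 2 / c = a * p ^+ 2 / c * p ^+ 2 &
    a * p ^+ 2 * p / (b * c) = a * p / (b * c) * p * p].
  by split; field; rewrite ?b0 ?c0.
have abc1 : a * p ^+ 2 / (b * c) = a * p / (b * c) * p by field; rewrite b0 c0.
rewrite /quad_term a2b a2c a2bc !abc1.
(* The prefactor extends the symbol of the shifted sum downwards by one factor, so that both sums
   share [qpoch (a * p / (b * c) * p) p L]. *)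
have e2 : (1 - a * p / (b * c) * p) * qpoch (a * p / (b * c) * p * p) p L.+1
   = qpoch (a * p / (b * c) * p) p L * (1 - a * p / (b * c) * p * p ^+ L)
     * (1 - a * p / (b * c) * p * p ^+ L.+1).
  by rewrite -qpochSl !qpochS.
rewrite (mulr_absorb _ _ _ _ (qpoch (a * p / (b * c) * p * p) _ _)) e2.
move: hp hbc hab hac.
rewrite !(qpochSl a) !(qpochSl (a * p / (b * c))).
rewrite !(qpochSl (a * p ^+ 2 / b)) !(qpochSl (a * p ^+ 2 / c)).
rewrite [qpoch b p L.+2]qpochS [qpoch c p L.+2]qpochS.
rewrite ![qpoch _ _ L.+1]qpochS (exprD _ 'C(L.+1, 2) L) (exprD _ 'C(L.+2, 2) L.+1).
rewrite !expr_bin2SS [(3 * _)%N]mulnC exprM ![p ^+ 2 ^+ _]exprAC !(exprSr p L).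
(* Every symbol is now one of these atoms times elementary factors, so the induction step is an
   identity of rational functions in them. *)
move: (qpoch (a * p ^+ 2) _ _) (qpoch p _ _) (qpoch (a * p ^+ 2 / b * p ^+ 2) _ _)
  (qpoch (a * p ^+ 2 / c * p ^+ 2) _ _) (qpoch (b * c * p) _ _)
  (qpoch b _ _) (qpoch c _ _) (qpoch (a * p / (b * c) * p) _ _)
  (p ^+ L) (p ^+ 'C(_, _)) => A P U V W B C E y pw.
rewrite !mulf_eq0 !negb_or.
move=> /andP[P0 py0] /andP[W0 wy0].
move=> /andP[/(subr_div_neq0 b0) ab0 /andP[U0 /(subr_divM_neq0 b0) uy0]].
move=> /andP[/(subr_div_neq0 c0) ac0 /andP[V0 /(subr_divM_neq0 c0) vy0]].
by field; rewrite b0 c0 P0 py0 W0 wy0 ab0 U0 uy0 ac0 V0 vy0.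
Qed.

(** Telescoping again. The right-hand side contains (bp; p)_L, so it vanishes when b = p^(-m) with 1
    <= m <= L; what remains relates the sums for b and b p^2. *)
Lemma quad_sum_shift_b a b c p (L : nat) :
    p != 0 -> b != 0 -> c != 0 ->
    qpoch p p L != 0 -> qpoch (b * c * p) (p ^+ 2) L.+1 != 0 ->
    qpoch (a / b) (p ^+ 2) L.+1 != 0 ->
    qpoch (a * p ^+ 2 / c) (p ^+ 2) L != 0 ->
  \sum_(i < L.+1) ((1 - b * c * p) * (1 - a / (b * c)) * quad_term a b c p i
     - (1 - a / b) * (1 - b * p) * quad_term a (b * p ^+ 2) c p i)
  = (b * p - a / (b * c))
    * (qpoch a (p ^+ 2) L.+1 * qpoch (b * p) p L * qpoch c p L.+1
       * qpoch (a / (b * c)) p L * p ^+ ('C(L.+1, 2) + L))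
    / (qpoch p p L * (qpoch (a * p ^+ 2 / b) (p ^+ 2) L
       * qpoch (a * p ^+ 2 / c) (p ^+ 2) L * qpoch (b * c * p ^+ 3) (p ^+ 2) L)).
Proof.
move=> p0 b0 c0; elim: L => [|L IHL].
  move=> _ _ _ _; rewrite big_ord_recr big_ord0 /= !quad_term0 !qpochS !qpoch0.
  by rewrite !expr0 !mulr1 divr1; field; rewrite b0 c0.
move=> hp hbc hab hac; rewrite big_ord_recr /= IHL; last first.
- exact: qpoch_neq0W hac.
- exact: qpoch_neq0W hab.
- exact: qpoch_neq0W hbc.
- exact: qpoch_neq0W hp.
have [a2b a2bc bcp] : [/\ a * p ^+ 2 / (b * p ^+ 2) = a / b,
    a * p / (b * p ^+ 2 * c) = a / (b * c) / p &
    b * p ^+ 2 * c * p = b * c * p * p ^+ 2].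
  by split; last (by ring); field; rewrite ?p0 ?b0 ?c0.
have [abc1 bcp3 ab1] : [/\ a * p / (b * c) = a / (b * c) * p,
    b * c * p ^+ 3 = b * c * p * p ^+ 2 & a * p ^+ 2 / b = a / b * p ^+ 2].
  by split; try (by ring); field; rewrite ?b0 ?c0.
rewrite /quad_term a2b a2bc !bcp !abc1 bcp3 !ab1.
have e2 : (1 - b * p) * qpoch (b * p ^+ 2) p L.+1
   = qpoch (b * p) p L * (1 - b * p * p ^+ L) * (1 - b * p * p ^+ L.+1).
  by rewrite expr2 mulrA -qpochSl !qpochS.
have e3 : (1 - a / (b * c)) * qpoch (a / (b * c) * p) p L.+1
   = qpoch (a / (b * c)) p L * (1 - a / (b * c) * p ^+ L)
     * (1 - a / (b * c) * p ^+ L.+1).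
  by rewrite -qpochSl !qpochS.
rewrite (mulr_absorb _ _ _ _ (qpoch (a / (b * c) * p) _ _)) e3.
rewrite (mulr_absorb2 _ _ _ _ (qpoch (b * p ^+ 2) _ _)) e2.
move: hp hbc hab hac.
rewrite !(qpochSl b) !(qpochSl (a / (b * c) / p)) divfK //.
rewrite !(qpochSl (a / b)) !(qpochSl (b * c * p)).
rewrite [qpoch a _ L.+2]qpochS [qpoch c p L.+2]qpochS.
rewrite ![qpoch _ _ L.+1]qpochS (exprD _ 'C(L.+1, 2) L) (exprD _ 'C(L.+2, 2) L.+1).
rewrite !expr_bin2SS [(3 * _)%N]mulnC exprM ![p ^+ 2 ^+ _]exprAC !(exprSr p L).
move: (qpoch a _ _) (qpoch p _ _) (qpoch (a / b * p ^+ 2) _ _)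
  (qpoch (a * p ^+ 2 / c) _ _) (qpoch (b * c * p * p ^+ 2) _ _)
  (qpoch (b * p) _ _) (qpoch c _ _) (qpoch (a / (b * c)) _ _)
  (p ^+ L) (p ^+ 'C(_, _)) => A P U V W B C E y pw.
rewrite !mulf_eq0 !negb_or.
move=> /andP[P0 py0] /andP[bcp0 /andP[W0 wy0]].
move=> /andP[/(subr_div_neq0 b0) ab0 /andP[U0 /(subr_divM_neq0 b0) uy0]].
rewrite [_ / c * _]mulrAC => /andP[V0 /(subr_div_neq0 c0) vy0].
by field; rewrite b0 c0 p0 bcp0 P0 py0 W0 wy0 ab0 U0 uy0 V0 vy0.
Qed.

Fact mulr1_inv_eq (x y : K) : x != 0 -> x * y = 1 -> x^-1 = y.
Proof. by move=> x0 xy; rewrite -[x^-1]mulr1 -xy mulKf. Qed.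

(** Induction on N through [quad_sum_shift_a], since a p^2 = p^(-2(N-1)). At a = 1 the factor (1;
    p^2)_i kills all terms but the first, which is 1 - a. *)
Lemma quad_sum_a_eq0 a b c p (N L : nat) :
    p != 0 -> b != 0 -> c != 0 -> a * p ^+ 2 ^+ N = 1 -> (N <= L)%N ->
    qpoch p p L != 0 -> qpoch (b * c * p) (p ^+ 2) L != 0 ->
    (forall i, a * p ^+ 2 / b * p ^+ 2 ^+ i != 1) ->
    (forall i, a * p ^+ 2 / c * p ^+ 2 ^+ i != 1) ->
  \sum_(i < L.+1) quad_term a b c p i = 0.
Proof.
move=> p0 b0 c0 + + hp hbc.
elim: N a => [|N IHN] a aN leNL hab hac.
  have a1 : a = 1 by rewrite -aN expr0 mulr1.
  rewrite big_ord_recl quad_term0 a1 subrr add0r big1 // => i _.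
  by rewrite /quad_term (@qpoch_eq0 _ 1 _ 0) ?mulr1 ?expr0 // !(mulr0, mul0r).
have := quad_sum_shift_a p0 b0 c0 hp hbc (qpoch_neq0 (fun i _ => hab i))
  (qpoch_neq0 (fun i _ => hac i)).
have aN' : a * p ^+ 2 * p ^+ 2 ^+ N = 1 by rewrite -mulrA -exprS.
rewrite (qpoch_eq0 leNL aN').
rewrite !(mul0r, mulr0) sumrB -!mulr_sumr (IHN _ aN' (ltnW leNL)); last first.
- by move=> i; move: (hac i.+1); rewrite (exprS _ i) mulrA [_ / c * _]mulrAC.
- by move=> i; move: (hab i.+1); rewrite (exprS _ i) mulrA [_ / b * _]mulrAC.
have /negPf ab0 : 1 - a * p ^+ 2 / b != 0.
  by move: (hab 0); rewrite expr0 mulr1 subr_eq0 eq_sym.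
have /negPf ac0 : 1 - a * p ^+ 2 / c != 0.
  by move: (hac 0); rewrite expr0 mulr1 subr_eq0 eq_sym.
by rewrite mulr0 subr0 => /eqP; rewrite !mulf_eq0 ab0 ac0 => /eqP.
Qed.

(** [quad_sum_shift_b] lowers m by 2, so an odd m ends at 1, where the coefficient 1 - bp of the
    shifted sum is zero. *)
Lemma quad_sum_b_eq0 a b c p (m L : nat) :
    p != 0 -> b != 0 -> c != 0 -> b * p ^+ m = 1 -> odd m -> (m <= L)%N ->
    qpoch p p L != 0 ->
    (forall i, b * c * p * p ^+ 2 ^+ i != 1) ->
    (forall i, a * p ^+ i != 1) -> (forall i, a / c * p ^+ i != 1) ->
  \sum_(i < L.+1) quad_term a b c p i = 0.
Proof.
move=> p0 + c0 + modd + hp + ha hac; rewrite -[m]odd_double_half modd.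
elim: m./2 b => {m modd} [|m IHm] b b0 bm lemL hbc.
(* Since 1/b is a power of p, [ha] and [hac] also cover the factors with a/b and a/(bc). *)
all: have bE := mulr1_inv_eq b0 bm.
all: have /negPf bcp0 : 1 - b * c * p != 0
  by move: (hbc 0); rewrite expr0 mulr1 subr_eq0 eq_sym.
all: have /negPf abc0 : 1 - a / (b * c) != 0
  by rewrite subr_eq0 eq_sym invfM bE mulrA mulrAC.
all: have := @quad_sum_shift_b a b c p L p0 b0 c0 hp (qpoch_neq0 (fun i _ => hbc i)).
all: have ab i : a / b * p ^+ 2 ^+ i != 1 by rewrite bE -exprM -mulrA -exprD.
all: have ac i : a * p ^+ 2 / c * p ^+ 2 ^+ i != 1
  by have := hac (2 + 2 * i)%N; rewrite exprD exprM mulrA [a / c * _]mulrAC.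
all: move=> /(_ (qpoch_neq0 (fun i _ => ab i)) (qpoch_neq0 (fun i _ => ac i))).
  (* Case m = 1: as L is positive, (bp; p)_L has the factor 1 - bp = 0, and the boundary term
     vanishes. *)
  case: L lemL {hp} => // L _.
  have bp : b * p * p ^+ 0 = 1 by rewrite mulr1.
  rewrite (qpoch_eq0 _ bp) // !(mulr0, mul0r) sumrB -!mulr_sumr.
  have -> : 1 - b * p = 0 by rewrite -bp mulr1 subrr.
  rewrite mulr0 mul0r subr0.
  by move/eqP; rewrite !mulf_eq0 bcp0 abc0 => /eqP.
have bp : b * p * p ^+ (m.*2.+2) = 1 by rewrite -mulrA -exprS.
rewrite (qpoch_eq0 _ bp) // !(mulr0, mul0r) sumrB -!mulr_sumr.
have -> : \sum_(i < L.+1) quad_term a (b * p ^+ 2) c p i = 0.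
  apply: IHm.
  - by rewrite mulf_neq0 ?expf_neq0.
  - by rewrite -mulrA -exprD.
  - by apply: leq_trans lemL; lia.
  move=> i; have -> : b * p ^+ 2 * c * p = b * c * p * p ^+ 2 by ring.
  by rewrite -mulrA -exprS.
by rewrite mulr0 subr0 => /eqP; rewrite !mulf_eq0 bcp0 abc0 => /eqP.
Qed.

End QuadraticSum.

(** * Expansion of the e-factors and exchange of sums *)

Section Expansion.
Variable K : fieldType.
Implicit Types a b c e p y : K.

(** For y = p^k, the general term of the terminating balanced 3phi2 series in base p^2 with upper
    parameters p^(-k), p^(1-k), a p^(2k) and lower parameters ep, a p^2/e; the first two upper
    symbols are merged into one in base p. *)
Definition split_term a e p y (j : nat) : K :=
  qpoch y^-1 p (2 * j) * qpoch (a * y ^+ 2) (p ^+ 2) j * p ^+ 2 ^+ j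
  / (qpoch (p ^+ 2) (p ^+ 2) j * qpoch (e * p) (p ^+ 2) j
     * qpoch (a * p ^+ 2 / e) (p ^+ 2) j).

(* Used with y = p^k: the recurrence in k satisfied by the sum over j. *)
Lemma split_sum_shift a e p y (J : nat) :
    p != 0 -> e != 0 -> y != 0 ->
    qpoch (p ^+ 2) (p ^+ 2) J != 0 -> qpoch (e * p) (p ^+ 2) J != 0 ->
    qpoch (a * p ^+ 2 / e) (p ^+ 2) J != 0 ->
  \sum_(j < J.+1) ((1 - e * y) * (1 - a * p / e * y) * y * split_term a e p (y * p) j
     - (1 - e * y ^+ 2) * (1 - a * p / e * y ^+ 2) * split_term a e p y j)
  = y * (1 - a * y ^+ 3 * p)
    * (qpoch y^-1 p (2 * J).+1 * qpoch (a * y ^+ 2 * p ^+ 2) (p ^+ 2) J)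
    / (qpoch (p ^+ 2) (p ^+ 2) J * qpoch (e * p) (p ^+ 2) J
       * qpoch (a * p ^+ 2 / e) (p ^+ 2) J).
Proof.
move=> p0 e0 y0; elim: J => [|J IHJ] hp he hae.
  rewrite big_ord_recr big_ord0 /split_term muln0 /= qpochS !qpoch0.
  by rewrite !expr0 !mulr1 !divr1; field; rewrite y0 e0.
rewrite big_ord_recr /= IHJ; last first.
- exact: qpoch_neq0W hae.
- exact: qpoch_neq0W he.
- exact: qpoch_neq0W hp.
move: hp he hae; rewrite /split_term mulnS !add2n.
have -> : a * (y * p) ^+ 2 = a * y ^+ 2 * p ^+ 2 by ring.
rewrite !(qpochSl (a * y ^+ 2)) ![qpoch _ (p ^+ 2) J.+1]qpochS.
have -> : qpoch (y * p)^-1 p (2 * J).+2 = (1 - (y * p)^-1) * qpoch y^-1 p (2 * J).+1.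
  by rewrite [LHS]qpochSl invfM mulfVK.
rewrite [qpoch y^-1 p (2 * J).+3]qpochS [qpoch y^-1 p (2 * J).+2]qpochS.
rewrite [p ^+ 2 ^+ J.+1]exprS -[(2 * J).+2]addn2 -[(2 * J).+1]addn1.
rewrite ![p ^+ (2 * J + _)]exprD !exprM.
move: (qpoch (a * y ^+ 2 * p ^+ 2) _ _) (qpoch _ _ (_ + 1)) (qpoch (p ^+ 2) _ _)
  (qpoch (e * p) _ _) (qpoch (a * p ^+ 2 / e) _ _) (p ^+ 2 ^+ J) => Q R P E F x.
rewrite [_ / e * _]mulrAC !mulf_eq0 !negb_or.
move=> /andP[P0 x0] /andP[E0 ex0] /andP[F0 /(subr_div_neq0 e0) ax0].
by field; rewrite e0 ax0 F0 ex0 E0 x0 P0 y0 p0.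
Qed.

(** A q-Pfaff-Saalschuetz sum, by induction on k. The boundary term of [split_sum_shift] contains
    (p^(-k); p)_(2M+1), which is zero for k <= 2M; hence the bound on k. *)
Lemma qpoch_split a e p (M k : nat) :
    p != 0 -> e != 0 -> (k <= (2 * M).+1)%N ->
    qpoch (p ^+ 2) (p ^+ 2) M != 0 -> qpoch (e * p) (p ^+ 2) M != 0 ->
    qpoch (a * p ^+ 2 / e) (p ^+ 2) M != 0 ->
  qpoch e (p ^+ 2) k * qpoch (a * p / e) (p ^+ 2) k
  = p ^+ 'C(k, 2) * (\sum_(j < M.+1) split_term a e p (p ^+ k) j)
    * (qpoch e p k * qpoch (a * p / e) p k).
Proof.
move=> p0 e0 + hp he hae; elim: k => [_|k IHk lekM].
  rewrite big_ord_recl big1 => [|i _]; rewrite /split_term ?qpoch0.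
    by rewrite (bin_small (isT : 0 < 2)%N) !expr0 !mulr1 divr1 addr0 mulr1.
  by rewrite (@qpoch_eq0 _ _ _ 0) ?expr0 ?invr1 ?mulr1 // !mul0r.
have := split_sum_shift p0 e0 (expf_neq0 k p0) hp he hae.
have kM : (p ^+ k)^-1 * p ^+ k = 1 by rewrite mulVf ?expf_neq0.
rewrite (qpoch_eq0 lekM kM) !(mul0r, mulr0) sumrB -!mulr_sumr -exprSr => /subr0_eq E.
have {}IHk := IHk (ltnW lekM).
rewrite !qpochS mulrACA IHk ![p ^+ 2 ^+ k]exprAC binS bin1 exprD.
move: E; move: (\sum_(j < _) _) (\sum_(j < _) _) => S S' E.
transitivity (p ^+ 'C(k, 2) * (qpoch e p k * qpoch (a * p / e) p k)
  * ((1 - e * p ^+ k ^+ 2) * (1 - a * p / e * p ^+ k ^+ 2) * S)); first by ring.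
by rewrite -E; ring.
Qed.

(** Reversal of (p^(-k); p)_m into (p; p)_k / (p; p)_(k-m) for k = m + i. The power of p that it
    produces turns the exponent of [quad_term] at k into the one at i. *)
Lemma bin2_qpoch p (m i : nat) : p != 0 ->
  p ^+ 'C((m + i).+1, 2) * qpoch (p ^+ (m + i))^-1 p m * qpoch p p i
  = (-1) ^+ m * p ^+ 'C(i.+1, 2) * qpoch p p (m + i).
Proof.
move=> p0; elim: m => [|m IHm]; first by rewrite qpoch0 expr0 !(mulr1, mul1r).
rewrite addSn binS bin1 exprD qpochSl qpochS.
have -> : (p ^+ (m + i).+1)^-1 * p = (p ^+ (m + i))^-1.
  by rewrite exprS invfM mulrC mulVKf.
transitivity ((p ^+ 'C((m + i).+1, 2) * qpoch (p ^+ (m + i))^-1 p m * qpoch p p i)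
  * (p ^+ (m + i).+1 * (1 - (p ^+ (m + i).+1)^-1))); first by ring.
rewrite IHm exprS mulrBr mulfV ?mulr1; last by rewrite mulf_neq0 ?expf_neq0.
by rewrite exprS; ring.
Qed.

(** Writing k = 2j + i separates the j-th expansion term into a factor free of i and a quadratic
    term at i with shifted parameters. *)
Lemma quad_split_shift a b c e p (j i : nat) :
    p != 0 -> b != 0 -> c != 0 -> qpoch p p (2 * j + i) != 0 ->
  quad_term a b c p (2 * j + i) * split_term a e p (p ^+ (2 * j + i)) j
  = qpoch a (p ^+ 2) (3 * j) * qpoch b p (2 * j) * qpoch c p (2 * j)
    * (qpoch (a * p / (b * c)) p (2 * j) * p ^+ 2 ^+ j)
    / (qpoch (p ^+ 2) (p ^+ 2) j * qpoch (e * p) (p ^+ 2) j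
       * qpoch (a * p ^+ 2 / e) (p ^+ 2) j
       * (qpoch (a * p ^+ 2 / b) (p ^+ 2) (2 * j)
          * qpoch (a * p ^+ 2 / c) (p ^+ 2) (2 * j)
          * qpoch (b * c * p) (p ^+ 2) (2 * j)))
    * quad_term (a * p ^+ 2 ^+ (3 * j)) (b * p ^+ (2 * j)) (c * p ^+ (2 * j)) p i.
Proof.
move=> p0 b0 c0 hp; rewrite /quad_term /split_term.
set y := p ^+ (2 * j).
have y2 : p ^+ 2 ^+ (2 * j) = y ^+ 2 by rewrite exprAC.
have y3 : p ^+ 2 ^+ (3 * j) = y ^+ 3 by rewrite -!exprM; congr (_ ^+ _); lia.
have y0 : y != 0 by rewrite expf_neq0.
have hpi : qpoch p p i != 0 by apply: qpoch_neq0W hp; rewrite leq_addl.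
have E1 : a * p ^+ (3 * (2 * j + i)) = a * y ^+ 3 * p ^+ (3 * i).
  by rewrite mulnDr exprD mulrA -exprM mulnC.
(* The two symbols are consecutive and join to one of length k + j = 3j + i; this is the origin of
   the shift by p^(6j). *)
have E2 : qpoch a (p ^+ 2) (2 * j + i) * qpoch (a * p ^+ (2 * j + i) ^+ 2) (p ^+ 2) j
    = qpoch a (p ^+ 2) (3 * j) * qpoch (a * y ^+ 3) (p ^+ 2) i.
  by rewrite [p ^+ _ ^+ 2]exprAC -qpochD -y3 -qpochD; congr qpoch; lia.
(* The length 2j is even, so the sign of the reversal disappears. *)
have E3 := bin2_qpoch (2 * j) i p0.
rewrite exprM sqrrN expr1n expr1n mul1r -/y in E3.
have {}E3 : p ^+ 'C((2 * j + i).+1, 2) * qpoch (p ^+ (2 * j + i))^-1 p (2 * j)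
    / qpoch p p (2 * j + i) = p ^+ 'C(i.+1, 2) / qpoch p p i.
  by apply/eqP; rewrite eqr_div // E3.
have abcy : a * y ^+ 3 * p / (b * y * (c * y)) = a * p / (b * c) * y.
  by field; rewrite b0 c0 y0.
have aby x : x != 0 -> a * y ^+ 3 * p ^+ 2 / (x * y) = a * p ^+ 2 / x * y ^+ 2.
  by move=> x0; field; rewrite x0 y0.
have bcy : b * y * (c * y) * p = b * c * p * y ^+ 2 by ring.
rewrite y3 abcy !aby // bcy E1 (qpochD b) (qpochD c) (qpochD (a * p / (b * c))).
rewrite (qpochD (a * p ^+ 2 / b)) (qpochD (a * p ^+ 2 / c)) (qpochD (b * c * p)).
rewrite y2 -/y !invfM.
transitivity ((1 - a * y ^+ 3 * p ^+ (3 * i))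
  * (qpoch a (p ^+ 2) (2 * j + i) * qpoch (a * p ^+ (2 * j + i) ^+ 2) (p ^+ 2) j)
  * (p ^+ 'C((2 * j + i).+1, 2) * qpoch (p ^+ (2 * j + i))^-1 p (2 * j)
    / qpoch p p (2 * j + i))
  * (qpoch b p (2 * j) * qpoch (b * y) p i * (qpoch c p (2 * j) * qpoch (c * y) p i)
     * (qpoch (a * p / (b * c)) p (2 * j) * qpoch (a * p / (b * c) * y) p i))
  / (qpoch (a * p ^+ 2 / b) (p ^+ 2) (2 * j) * qpoch (a * p ^+ 2 / b * y ^+ 2) (p ^+ 2) i
     * (qpoch (a * p ^+ 2 / c) (p ^+ 2) (2 * j)
        * qpoch (a * p ^+ 2 / c * y ^+ 2) (p ^+ 2) i)
     * (qpoch (b * c * p) (p ^+ 2) (2 * j) * qpoch (b * c * p * y ^+ 2) (p ^+ 2) i))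
  * p ^+ 2 ^+ j / (qpoch (p ^+ 2) (p ^+ 2) j * qpoch (e * p) (p ^+ 2) j
    * qpoch (a * p ^+ 2 / e) (p ^+ 2) j)); first by rewrite !invfM; ring.
by rewrite E2 E3 !invfM; ring.
Qed.

(** The parameters b and c stay independent here, so that either can play the part of p^(-m). *)
Definition split_summand a b c e p k : K :=
  (1 - a * p ^+ (3 * k))
  * (qpoch a (p ^+ 2) k * qpoch e (p ^+ 2) k * qpoch (a * p / e) (p ^+ 2) k
     * qpoch b p k * qpoch c p k * qpoch (a * p / (b * c)) p k)
  * p ^+ k
  / (qpoch p p k * qpoch e p k * qpoch (a * p / e) p k
     * (qpoch (a * p ^+ 2 / b) (p ^+ 2) k * qpoch (a * p ^+ 2 / c) (p ^+ 2) k
        * qpoch (b * c * p) (p ^+ 2) k)).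

(** The last hypothesis keeps the prefactors of the inner sums: for large j one of them vanishes,
    for the other j the quadratic sum does. *)
Lemma split_sum_eq0 a b c e p (M : nat) :
    p != 0 -> b != 0 -> c != 0 -> e != 0 ->
    qpoch p p M != 0 -> qpoch (p ^+ 2) (p ^+ 2) M != 0 ->
    (forall i, e * p ^+ i != 1) -> (forall i, a * p / e * p ^+ i != 1) ->
    (forall j, (2 * j <= M)%N ->
      qpoch a (p ^+ 2) (3 * j) * qpoch b p (2 * j) * qpoch c p (2 * j)
      * \sum_(i < (M - 2 * j).+1) quad_term (a * p ^+ 2 ^+ (3 * j))
          (b * p ^+ (2 * j)) (c * p ^+ (2 * j)) p i = 0) ->
  \sum_(k < M.+1) split_summand a b c e p k = 0.
Proof.
move=> p0 b0 c0 e0 hp hp2 he hae inner0.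
have he2 : qpoch (e * p) (p ^+ 2) M != 0.
  by apply: qpoch_neq0 => i _; rewrite -exprM -mulrA -exprS.
have hae2 : qpoch (a * p ^+ 2 / e) (p ^+ 2) M != 0.
  apply: qpoch_neq0 => i _; have := hae (2 * i).+1.
  by rewrite exprS -exprM mulrA; congr (_ * _ != _); ring.
have splitE k : (k < M.+1)%N -> split_summand a b c e p k
    = \sum_(j < M.+1) quad_term a b c p k * split_term a e p (p ^+ k) j.
  move=> ltkM; rewrite -mulr_sumr.
  have lek2M : (k <= (2 * M).+1)%N by lia.
  have E0 := qpoch_split p0 e0 lek2M hp2 he2 hae2; move: E0.
  (* Of C(k+1, 2) = C(k, 2) + k, the part C(k, 2) goes with the expansion of the e-quotient, and p^k
     is the power in the summand. *)
  rewrite /split_summand /quad_term binS bin1 exprD.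
  move: (\sum_(_ < _) _) => S E0; have E : p ^+ 'C(k, 2) * S
     = qpoch e (p ^+ 2) k * qpoch (a * p / e) (p ^+ 2) k
       * ((qpoch e p k)^-1 * (qpoch (a * p / e) p k)^-1).
    by rewrite -invfM E0 mulfK // mulf_neq0 // qpoch_neq0.
  transitivity ((1 - a * p ^+ (3 * k)) * (qpoch a (p ^+ 2) k * qpoch b p k * qpoch c p k
     * qpoch (a * p / (b * c)) p k) * (p ^+ 'C(k, 2) * S) * p ^+ k / (qpoch p p k
     * (qpoch (a * p ^+ 2 / b) (p ^+ 2) k * qpoch (a * p ^+ 2 / c) (p ^+ 2) k
        * qpoch (b * c * p) (p ^+ 2) k))); last by ring.
  by rewrite E !invfM; ring.
rewrite (eq_bigr _ (fun (k : 'I_M.+1) _ => splitE k (ltn_ord k))) exchange_big big1 // => j _ /=.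
(* (p^(-k); p)_(2j) vanishes, so the inner sum starts at k = 2j. *)
have small k : (k < 2 * j)%N -> split_term a e p (p ^+ k) j = 0.
  move=> ltk; rewrite /split_term (qpoch_eq0 ltk) ?mul0r //.
  by rewrite mulVf ?expf_neq0.
have [le2jM | ltM2j] := leqP (2 * j) M; last first.
  by rewrite big1 // => k _; rewrite small ?mulr0 //; have := ltn_ord k; lia.
rewrite -(big_mkord xpredT (fun k => quad_term a b c p k * split_term a e p (p ^+ k) j)).
rewrite (@big_cat_nat _ _ _ (2 * j)) //=; last exact: leqW.
rewrite big_nat big1 ?add0r => [|k /andP[_ ltk]]; last by rewrite small ?mulr0.
rewrite -{1}[(2 * j)%N]add0n big_addn subSn // big_mkord.
transitivity (\sum_(i < (M - 2 * j).+1) (qpoch a (p ^+ 2) (3 * j) * qpoch b p (2 * j)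
    * qpoch c p (2 * j)
    * (qpoch (a * p / (b * c)) p (2 * j) * p ^+ 2 ^+ j)
    / (qpoch (p ^+ 2) (p ^+ 2) j * qpoch (e * p) (p ^+ 2) j
       * qpoch (a * p ^+ 2 / e) (p ^+ 2) j
       * (qpoch (a * p ^+ 2 / b) (p ^+ 2) (2 * j)
          * qpoch (a * p ^+ 2 / c) (p ^+ 2) (2 * j)
          * qpoch (b * c * p) (p ^+ 2) (2 * j)))
    * quad_term (a * p ^+ 2 ^+ (3 * j)) (b * p ^+ (2 * j)) (c * p ^+ (2 * j)) p i)).
  apply: eq_bigr => i _; rewrite addnC quad_split_shift //.
  by apply: qpoch_neq0W hp; have := ltn_ord i; lia.
rewrite -mulr_sumr; move: (inner0 j le2jM) => /eqP; rewrite mulf_eq0.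
by case/orP=> /eqP ->; rewrite ?mul0r ?mulr0.
Qed.

End Expansion.

(** * Vanishing of the sum at a root of unity and at a = q^n, q^(-n) *)

Section Specialisation.
Variable K : fieldType.
Implicit Types a b c e p q : K.

Lemma split_summandC a b c e p k :
  split_summand a b c e p k = split_summand a c b e p k.
Proof. by rewrite /split_summand [c * b]mulrC; congr (_ * _ / _); ring. Qed.

(** With b = aq and c = q/a one has bc = q^2, so the dependent parameters of [split_summand] become
    q^(d-3), q^(d+2), q^(2d-2)/a and a q^(2d-2). *)
Lemma summandE q a e d k : (2 <= d)%N -> q != 0 -> a != 0 ->
  summand q a e d k
  = (1 - q)^-1 * split_summand q^-1 (a * q) (q / a) e (q ^+ d) k.
Proof.
move=> hd q0 a0; rewrite /summand /qint /split_summand /qpochs !big_cons !big_nil !mulr1.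
have -> : q ^+ d ^+ 2 = q ^+ (2 * d) by rewrite -exprM mulnC.
have -> : q ^ ((3 * d * k)%N%:Z - 1) = q^-1 * q ^+ d ^+ (3 * k).
  by rewrite expfzDr // -exprM mulrC; congr (_ * q ^+ _); lia.
have -> : q ^ (d%:Z - 3) = q^-1 * q ^+ d / (a * q * (q / a)).
  rewrite expfzDr //; set x := q ^ d; have -> : q ^+ d = x by [].
  by rewrite /x; change (q ^ (-3)) with (q ^- 3); field; rewrite a0 q0.
have -> : q ^+ (d - 1) = q^-1 * q ^+ d.
  by rewrite -{2}(subnK (ltnW hd)) exprD expr1 mulrCA mulVf ?mulr1.
have qd2 : q ^+ (2 * d) = q ^+ (2 * d - 2) * q ^+ 2.
  by rewrite -exprD subnK //; lia.
have -> : q^-1 * q ^+ (2 * d) / (a * q) = q ^+ (2 * d - 2) / a.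
  by rewrite qd2; field; rewrite a0 q0.
have -> : q^-1 * q ^+ (2 * d) / (q / a) = a * q ^+ (2 * d - 2).
  by rewrite qd2; field; rewrite a0 q0.
have -> : a * q * (q / a) * q ^+ d = q ^+ (d + 2).
  by rewrite exprD; field; rewrite a0.
by rewrite (exprM q d k) !invfM; ring.
Qed.

Definition summand_den q a e d k : K :=
  qpochs [:: q ^+ d; e; q ^+ (d - 1) / e] (q ^+ d) k
     * qpochs [:: a * q ^+ (2 * d - 2); q ^+ (2 * d - 2) / a; q ^+ (d + 2)]
         (q ^+ (2 * d)) k.

Lemma divM_eq1 (x y z : K) : y != 0 -> (x / y * z == 1) = (x * z == y).
Proof. by move=> y0; rewrite mulrAC -(can_eq (mulfK y0)) mul1r divfK. Qed.

Lemma summand_den_neq0 q a e d k :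
    q != 0 -> a != 0 -> e != 0 -> (0 < d)%N ->
    qpoch (q ^+ d) (q ^+ d) k != 0 -> qpoch (q ^+ (d + 2)) (q ^+ d ^+ 2) k != 0 ->
    (forall u v, e * q ^+ u != q ^+ v) ->
    (forall i, a * q ^+ (2 * d - 2 + 2 * d * i) != 1) ->
    (forall i, q ^+ (2 * d - 2 + 2 * d * i) != a) ->
  summand_den q a e d k != 0.
Proof.
move=> q0 a0 e0 hd hp hbcp he ha ha'.
rewrite /summand_den /qpochs !big_cons !big_nil !mulr1 [(2 * d)%N]mulnC exprM.
rewrite !mulf_neq0 //.
- by apply: qpoch_neq0 => i _; rewrite -exprM -(expr0 q) he.
- apply: qpoch_neq0 => i _; rewrite divM_eq1 // -exprM -exprD eq_sym.
  by have := he 0 (d - 1 + d * i)%N; rewrite mulr1.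
- by apply: qpoch_neq0 => i _; rewrite -!exprM -mulrA -exprD mulnC ha.
- by apply: qpoch_neq0 => i _; rewrite divM_eq1 // -!exprM -exprD mulnC ha'.
Qed.

Fact expr_d23 q d i j :
  q ^+ (d * (2 * (3 * j + 1 + i))) = q ^+ d ^+ 2 ^+ (3 * j) * q ^+ d ^+ 2 * q ^+ d ^+ 2 ^+ i.
Proof. by rewrite !(exprM q d) exprM !exprD expr1. Qed.

(** From 2dN = (d-1)n + 1 and q^n = 1 the first parameter q^(-1) is p^(-2N) for p = q^d. The j-th
    inner sum has N - 3j in place of N, and for 3j > N its prefactor is zero. Coprimality and M < n
    keep the symbols in q alone with base p nonzero. *)
Lemma cyclotomic_summand_sum q a e d n N M :
    (2 <= d)%N -> n.-primitive_root q -> coprime n (2 * d) ->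
    (2 * d * N = (d - 1) * n + 1)%N -> (N <= M < n)%N ->
    (forall i, (i < M)%N -> ~~ (n %| 2 + d + 2 * d * i)%N) ->
    (forall u v, a * q ^+ u != q ^+ v) -> (forall u v, e * q ^+ u != q ^+ v) ->
    a != 0 -> e != 0 ->
  (forall k, (k <= M)%N -> summand_den q a e d k != 0) /\
  \sum_(k < M.+1) summand q a e d k = 0.
Proof.
move=> hd prq co2d defN /andP[leNM ltMn] hbc ha he a0 e0.
have n0 := prim_order_gt0 prq.
have q0 : q != 0.
  apply/eqP => q0; move: (prim_expr_order prq).
  by rewrite q0 expr0n gtn_eqF // => /esym/eqP; rewrite oner_eq0.
have qn1 u : (q ^+ u == 1) = (n %| u)%N by rewrite -(prim_order_dvd prq).
have cod : coprime n d by move: co2d; rewrite coprimeMr => /andP[].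
have p_neq1 i : (i < M)%N -> q ^+ (d * i.+1) != 1.
  move=> lti; rewrite qn1 Gauss_dvdr //; apply/negP => /dvdn_leq; lia.
have p2_neq1 i : (i < M)%N -> q ^+ (2 * d * i.+1) != 1.
  move=> lti; rewrite qn1 Gauss_dvdr //; apply/negP => /dvdn_leq; lia.
have hp : qpoch (q ^+ d) (q ^+ d) M != 0.
  by apply: qpoch_neq0 => i ltiM; rewrite -exprS -exprM p_neq1.
have hp2 : qpoch (q ^+ d ^+ 2) (q ^+ d ^+ 2) M != 0.
  by apply: qpoch_neq0 => i ltiM; rewrite -exprS -!exprM [(d * 2)%N]mulnC p2_neq1.
have hbcp : qpoch (q ^+ (d + 2)) (q ^+ d ^+ 2) M != 0.
  apply: qpoch_neq0 => i ltiM; rewrite -!exprM -exprD qn1.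
  by rewrite addnC [(d * 2)%N]mulnC addnC [(d + 2)%N]addnC hbc.
have he' i : e * q ^+ d ^+ i != 1 by rewrite -exprM -(expr0 q) he.
have hae i : q^-1 * q ^+ d / e * q ^+ d ^+ i != 1.
  apply: contraNneq (he 1 (d + d * i)%N) => E; apply/eqP.
  by move/eqP: E; rewrite divM_eq1 // => /eqP <-; rewrite expr1 exprD exprM; field.
split=> [k lekM|].
  apply: summand_den_neq0 => //; first exact: ltnW.
  - exact: qpoch_neq0W hp.
  - exact: qpoch_neq0W hbcp.
  - by move=> i; rewrite -(expr0 q) ha.
  - by move=> i; apply: contraNneq (ha 0 (2 * d - 2 + 2 * d * i)%N) => ->; rewrite mulr1.
have apN : q^-1 * q ^+ d ^+ 2 ^+ N = 1.
  have -> : q ^+ d ^+ 2 ^+ N = q ^+ (2 * d * N) by rewrite -!exprM; congr (_ ^+ _); lia.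
  rewrite defN addn1 exprS mulKf //.
  by rewrite mulnC exprM (prim_expr_order prq) expr1n.
have bc : a * q * (q / a) = q ^+ 2 by field.
have b0 : a * q != 0 by rewrite mulf_neq0.
have c0 : q / a != 0 by rewrite mulf_neq0 ?invr_eq0.
under eq_bigr do rewrite summandE //.
have p0 : q ^+ d != 0 by rewrite expf_neq0.
rewrite -mulr_sumr split_sum_eq0 ?mulr0 // => j le2jM.
have [ltN3j | le3jN] := ltnP N (3 * j).
  by rewrite (qpoch_eq0 ltN3j apN) !mul0r.
rewrite (@quad_sum_a_eq0 _ _ _ _ _ (N - 3 * j)) ?mulr0 //.
- by rewrite mulf_neq0 ?expf_neq0.
- by rewrite mulf_neq0 ?expf_neq0.
- by rewrite -mulrA -exprD subnKC.
- lia.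
- by apply: qpoch_neq0W hp; apply: leq_subr.
- have := hbcp; rewrite -{1}(subnKC le2jM) qpochD mulf_eq0 negb_or => /andP[_].
  set x := (X in qpoch X) => hx; set y := (X in qpoch X); suff -> : y = x by [].
  by rewrite /y /x mulrACA bc exprD [_ ^+ 2 ^+ (2 * j)]exprAC; ring.
- move=> i; rewrite divM_eq1 ?mulf_neq0 ?expf_neq0 //.
  (* A zero factor would make a a quotient of powers of q. *)
  apply: contraNneq (ha (2 + d * (2 * j)) (d * (2 * (3 * j + 1 + i))))%N => E.
  apply/eqP; transitivity (q * (a * q * q ^+ d ^+ (2 * j))).
    by rewrite exprD (exprM q d); ring.
  rewrite -E expr_d23.
  by move: (q ^+ d ^+ 2 ^+ (3 * j)) (q ^+ d ^+ 2 ^+ i) => A B; field.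
- move=> i; rewrite divM_eq1 ?mulf_neq0 ?expf_neq0 ?invr_eq0 //.
  apply: contraNneq (ha (d * (2 * (3 * j + 1 + i))) (2 + d * (2 * j)))%N => E.
  apply/eqP; transitivity (q * a * (q / a * q ^+ d ^+ (2 * j))); last first.
    by rewrite exprD (exprM q d); move: (q ^+ d ^+ (2 * j)) => A; field.
  rewrite -E expr_d23.
  by move: (q ^+ d ^+ 2 ^+ (3 * j)) (q ^+ d ^+ 2 ^+ i) => A B; field.
Qed.

(** One of aq and q/a is q^(1-n) = p^(-m) with m odd, and m - 2j stays odd in the j-th inner sum. As
    q is not a root of unity, the nonvanishing conditions free of e compare exponents, which differ
    by sign or parity (d even, n odd). *)
Lemma generic_summand_sum q a e d n m M :
    (2 <= d)%N -> ~~ odd d -> odd n -> (forall u, (0 < u)%N -> q ^+ u != 1) -> q != 0 ->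
    n = (d * m).+1 -> odd m -> (m <= M)%N ->
    (forall u v, e * q ^+ u != q ^+ v) -> e != 0 ->
    (a = q ^+ n) \/ (a = (q ^+ n)^-1) ->
  (forall k, summand_den q a e d k != 0) /\
  \sum_(k < M.+1) summand q a e d k = 0.
Proof.
move=> hd evd oddn q_neq1 q0 nE oddm lemM he e0 aE.
have q_inj u v : u != v -> q ^+ u != q ^+ v.
  wlog ltuv: u v / (u < v)%N.
    by move=> IH; rewrite neq_ltn => /orP[] lt; last rewrite eq_sym;
      apply: IH => //; rewrite neq_ltn lt.
  move=> _; rewrite -(subnKC (ltnW ltuv)) exprD -{1}[q ^+ u]mulr1 eq_sym.
  by rewrite (inj_eq (mulfI (expf_neq0 u q0))) q_neq1 ?subn_gt0.
have d0 : (0 < d)%N by exact: ltnW.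
have p0 : q ^+ d != 0 by rewrite expf_neq0.
have qn0 : q ^+ n != 0 by rewrite expf_neq0.
have a0 : a != 0 by case: aE => ->; rewrite ?invr_eq0.
have hp k : qpoch (q ^+ d) (q ^+ d) k != 0.
  by apply: qpoch_neq0 => i _; rewrite -exprS -exprM q_neq1 // muln_gt0 d0.
have hp2 k : qpoch (q ^+ d ^+ 2) (q ^+ d ^+ 2) k != 0.
  by apply: qpoch_neq0 => i _; rewrite -exprS -!exprM q_neq1 // !muln_gt0 d0.
have he' i : e * q ^+ d ^+ i != 1 by rewrite -exprM -(expr0 q) he.
have hae i : q^-1 * q ^+ d / e * q ^+ d ^+ i != 1.
  apply: contraNneq (he 1 (d + d * i)%N) => E; apply/eqP.
  by move/eqP: E; rewrite divM_eq1 // => /eqP <-; rewrite expr1 exprD exprM; field.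
split=> [k|].
  apply: summand_den_neq0 => //.
  - by apply: qpoch_neq0 => i _; rewrite -!exprM -exprD q_neq1 // !addn_gt0 orbT.
  - move=> i; case: aE => ->; first by rewrite -exprD q_neq1 // addn_gt0 nE.
    rewrite mulrC -[_ / _]mulr1 divM_eq1 // mulr1 q_inj //.
    by apply/negP => /eqP E; move: oddn; rewrite -E; lia.
  - move=> i; case: aE => ->.
      by apply: q_inj; apply/negP => /eqP E; move: oddn; rewrite -E; lia.
    rewrite -(inj_eq (mulIf qn0)) mulVf // -exprD q_neq1 //; lia.
have quad0 (j : nat) : (2 * j <= M)%N ->
    qpoch (q / q ^+ n) (q ^+ d) (2 * j)
    * \sum_(i < (M - 2 * j).+1) quad_term (q^-1 * q ^+ d ^+ 2 ^+ (3 * j))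
      (q / q ^+ n * q ^+ d ^+ (2 * j)) (q ^+ n * q * q ^+ d ^+ (2 * j)) (q ^+ d) i = 0.
  move=> le2jM.
  have bpm : q / q ^+ n * q ^+ d ^+ m = 1.
    by rewrite mulrAC -exprM -exprS -nE divff.
  have [ltm2j | le2jm] := ltnP m (2 * j); first by rewrite (qpoch_eq0 ltm2j bpm) mul0r.
  rewrite (@quad_sum_b_eq0 _ _ _ _ _ (m - 2 * j)) ?mulr0 //.
  - by rewrite !mulf_neq0 ?invr_eq0 ?expf_neq0.
  - by rewrite !mulf_neq0 ?expf_neq0.
  - by rewrite -mulrA -exprD subnKC.
  - by lia.
  - by lia.
  - move=> i; have -> : q / q ^+ n * q ^+ d ^+ (2 * j) * (q ^+ n * q * q ^+ d ^+ (2 * j))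
        * q ^+ d * q ^+ d ^+ 2 ^+ i
      = q ^+ (2 + (d * (2 * j) + (d * (2 * j) + (d + d * (2 * i))))).
      rewrite !(exprD q) !(exprM q d) (exprM (q ^+ d) 2 i); move: (q ^+ d ^+ (2 * j)) (_ ^+ i) => A B.
      by field.
    by rewrite q_neq1.
  - move=> i; have -> : q^-1 * q ^+ d ^+ 2 ^+ (3 * j) * q ^+ d ^+ i
      = q ^+ (d * (2 * (3 * j)) + d * i) / q * 1.
      rewrite !(exprD q) !(exprM q d) (exprM (q ^+ d) 2 (3 * j)).
      by move: (_ ^+ (3 * j)) (_ ^+ i) => A B; ring.
    rewrite divM_eq1 // mulr1 -[X in _ != X]expr1 q_inj //.
    by apply/negP => /eqP/(congr1 odd); rewrite oddD !oddM (negPf evd).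
  - move=> i; rewrite divM_eq1 ?mulf_neq0 ?expf_neq0 //.
    apply: contraNneq (q_inj (d * (2 * (3 * j)) + d * i) (n + 2 + d * (2 * j)) _)%N => [E|].
      apply/eqP; rewrite !(exprD q) !(exprM q d) (exprM (q ^+ d) 2 (3 * j)).
      transitivity (q * (q ^+ n * q * q ^+ d ^+ (2 * j))); last by ring.
      by rewrite -E; move: (_ ^+ (3 * j)) (_ ^+ i) => A B; field.
    by apply/negP => /eqP/(congr1 odd); rewrite !oddD !oddM (negPf evd) oddn.
have sum0 : \sum_(k < M.+1) split_summand q^-1 (q / q ^+ n) (q ^+ n * q) e (q ^+ d) k = 0.
  apply: split_sum_eq0 => //; rewrite ?mulf_neq0 ?invr_eq0 // => j /quad0.
  by move/eqP; rewrite mulf_eq0 => /orP[] /eqP ->; rewrite !(mul0r, mulr0).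
under eq_bigr do rewrite summandE //.
rewrite -mulr_sumr; case: aE => ->.
  (* For a = q^n it is c = q/a that equals p^(-m), so b and c are exchanged. *)
  by under eq_bigr do rewrite split_summandC; rewrite sum0 mulr0.
by rewrite invrK ![_ * q]mulrC [q * q ^+ n]mulrC sum0 mulr0.
Qed.

End Specialisation.

(** * Values of fractions at a point *)

Section Specialises.
Variables (R : idomainType) (K : fieldType) (phi : {rmorphism R -> K}).
Implicit Types (s t : {fraction R}) (v w : K).

(** Evaluation is only defined on the localisation of R at the kernel of phi, hence a relation
    rather than a function. *)
Definition specialises s v : Prop :=
  exists x y : R, [/\ phi y != 0, s = x%:F / y%:F & v = phi x / phi y].

Lemma phi_neq0 y : phi y != 0 -> y%:F != 0.
Proof. by rewrite tofrac_eq0; apply: contra_neq => ->; rewrite rmorph0. Qed.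

Lemma specialises_tofrac x : specialises x%:F (phi x).
Proof. by exists x, 1; split; rewrite ?rmorph1 ?oner_eq0 ?tofrac1 ?divr1. Qed.

Lemma specialises1 : specialises 1 1.
Proof. by rewrite -(rmorph1 phi) -tofrac1; apply: specialises_tofrac. Qed.

Lemma specialises0 : specialises 0 0.
Proof. by rewrite -(rmorph0 phi) -tofrac0; apply: specialises_tofrac. Qed.

Lemma specialisesD s t v w :
  specialises s v -> specialises t w -> specialises (s + t) (v + w).
Proof.
move=> [x [y [y0 -> ->]]] [x' [y' [y0' -> ->]]].
exists (x * y' + x' * y), (y * y').
split; first by rewrite rmorphM mulf_neq0.
  by rewrite addf_div ?phi_neq0 // tofracD !tofracM.
by rewrite addf_div // rmorphD !rmorphM.
Qed.

Lemma specialisesM s t v w :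
  specialises s v -> specialises t w -> specialises (s * t) (v * w).
Proof.
move=> [x [y [y0 -> ->]]] [x' [y' [y0' -> ->]]].
exists (x * x'), (y * y'); split; first by rewrite rmorphM mulf_neq0.
  by rewrite mulf_div !tofracM.
by rewrite mulf_div !rmorphM.
Qed.

Lemma specialisesN s v : specialises s v -> specialises (- s) (- v).
Proof. by move=> [x [y [y0 -> ->]]]; exists (- x), y; split; rewrite ?tofracN ?rmorphN ?mulNr. Qed.

Lemma specialisesB s t v w :
  specialises s v -> specialises t w -> specialises (s - t) (v - w).
Proof. by move=> sv tw; apply/specialisesD/specialisesN. Qed.

Lemma specialisesV s v : v != 0 -> specialises s v -> specialises s^-1 v^-1.
Proof.
move=> v0 [x [y [y0 -> vE]]]; exists y, x; rewrite vE !invf_div; split=> //.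
by apply: contraNneq v0 => x0; rewrite vE x0 mul0r.
Qed.

Lemma specialises_div s t v w :
  w != 0 -> specialises s v -> specialises t w -> specialises (s / t) (v / w).
Proof. by move=> w0 sv tw; apply/specialisesM/specialisesV. Qed.

Lemma specialisesX s v k : specialises s v -> specialises (s ^+ k) (v ^+ k).
Proof.
move=> sv; elim: k => [|k IHk]; first exact: specialises1.
by rewrite !exprS; apply: specialisesM.
Qed.

Lemma specialises_exprz s v (z : int) :
  v != 0 -> specialises s v -> specialises (s ^ z) (v ^ z).
Proof.
move=> v0 sv; case: z => k; first exact: specialisesX.
by apply: specialisesV (specialisesX _ sv); rewrite expf_neq0.
Qed.

Lemma specialises_sum (I : Type) (r : seq I) (P : pred I) (F : I -> {fraction R}) G :
  (forall i, P i -> specialises (F i) (G i)) ->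
  specialises (\sum_(i <- r | P i) F i) (\sum_(i <- r | P i) G i).
Proof.
move=> FG; apply: (big_ind2 specialises) => //; first exact: specialises0.
by move=> *; apply: specialisesD.
Qed.

Lemma specialises_qpoch s t v w k :
  specialises s v -> specialises t w -> specialises (qpoch s t k) (qpoch v w k).
Proof.
move=> sv tw; apply: (big_ind2 specialises) => [|*|i _]; first exact: specialises1.
  exact: specialisesM.
apply: specialisesB (specialises1) (specialisesM sv _); exact: specialisesX.
Qed.

Lemma specialises_qpochs3 s1 s2 s3 v1 v2 v3 t w k :
  specialises s1 v1 -> specialises s2 v2 -> specialises s3 v3 -> specialises t w ->
  specialises (qpochs [:: s1; s2; s3] t k) (qpochs [:: v1; v2; v3] w k).
Proof.
move=> sv1 sv2 sv3 tw; rewrite /qpochs !big_cons !big_nil.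
by do !apply: specialisesM; do ?exact: specialises_qpoch; exact: specialises1.
Qed.

Lemma specialises_summand q a e d k :
    phi q != 0 -> phi a != 0 -> phi e != 0 -> 1 - phi q != 0 ->
    summand_den (phi q) (phi a) (phi e) d k != 0 ->
  specialises (summand q%:F a%:F e%:F d k) (summand (phi q) (phi a) (phi e) d k).
Proof.
move=> q0 a0 e0 q1 den0; rewrite /summand /qint.
have sq := specialises_tofrac q; have sa := specialises_tofrac a.
have se := specialises_tofrac e; have s1 := specialises1.
have sV s v : v != 0 -> specialises s v -> specialises s^-1 v^-1 by exact: specialisesV.
have sz s v (z : int) : v != 0 -> specialises s v -> specialises (s ^ z) (v ^ z).
  exact: specialises_exprz.
do ![apply: specialisesX | apply: specialises_qpochs3 | apply: sz | apply: specialisesB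
  | apply: specialises_div | apply: sV | apply: specialisesM | by []].
Qed.

(** Cross-multiplication with the representation that witnesses the value. Only y != 0 is asked, not
    phi y != 0, so one reduced fraction can be used at every point. *)
Lemma specialises_eq0 x (y : R) : y != 0 -> specialises (x%:F / y%:F) 0 -> phi x = 0.
Proof.
rewrite -tofrac_eq0 => yF0 [x' [y' [y0' E /esym/eqP]]].
rewrite mulf_eq0 invr_eq0 (negPf y0') orbF => /eqP x'0.
move/eqP: E; rewrite (eqr_div _ _ yF0 (phi_neq0 y0')) -!tofracM tofrac_eq => /eqP.
move/(congr1 phi); rewrite !rmorphM /= x'0 mul0r => /eqP.
by rewrite mulf_eq0 (negPf y0') orbF => /eqP.
Qed.

End Specialises.

(** * Existence of reduced fractions *)

Section ReducedFractions.

(* A norm witnessing that chains of proper divisors terminate. *)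
Definition divisor_norm (R : idomainType) (mu : R -> nat) : Prop :=
  forall g h : R, g * h != 0 ->
    (mu h <= mu (g * h)%R)%N /\ (g \isn't a GRing.unit -> (mu h < mu (g * h)%R)%N).

Lemma divisor_norm_int : divisor_norm absz.
Proof.
move=> g h; rewrite mulf_eq0 negb_or => /andP[g0 h0]; rewrite abszM.
have g1 : (0 < `|g|)%N by rewrite absz_gt0.
have h1 : (0 < `|h|)%N by rewrite absz_gt0.
split=> [|gu]; first by rewrite leq_pmull.
have {}gu : (1 < `|g|)%N.
  rewrite ltn_neqAle g1 andbT; apply: contraNneq gu.
  by case: g {g0 g1} => [[|[|?]]|[|?]].
by rewrite ltn_Pmull.
Qed.

(** Removing a nonunit g either lowers the degree, or g is a constant nonunit and the norm of the
    leading coefficient drops. *)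
Lemma divisor_norm_poly (R : idomainType) (mu : R -> nat) : divisor_norm mu ->
  divisor_norm (fun p : {poly R} => size p + mu (lead_coef p))%N.
Proof.
move=> mu_norm g h; rewrite mulf_eq0 negb_or => /andP[g0 h0].
have lgh : lead_coef g * lead_coef h != 0 by rewrite mulf_neq0 ?lead_coef_eq0.
have [le_mu lt_mu] := mu_norm _ _ lgh.
have size_h : (size h <= (size g + size h).-1)%N.
  by rewrite -ltnS prednK ?addn_gt0 ?size_poly_gt0 ?g0 // -add1n leq_add2r size_poly_gt0.
rewrite lead_coefM size_mul //; split=> [|gu]; first exact: leq_add.
have [sg1 | sg1] := eqVneq (size g) 1%N.
  rewrite -addnS leq_add // lt_mu //.
  by move: gu; rewrite poly_unitE sg1 lead_coefE sg1.
rewrite -addSn leq_add // ltn_predRL -[(size h).+1]add1n ltn_add2r.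
by rewrite ltn_neqAle eq_sym sg1 size_poly_gt0.
Qed.

(** Cancelling a common nonunit lowers the norm of the denominator, so cancellation stops. Excluded
    middle decides whether such a divisor exists. *)
Lemma reduced_fraction (R : idomainType) (mu : R -> nat) (x y : R) :
  divisor_norm mu -> y != 0 ->
  exists x' y' : R, [/\ y' != 0, x%:F / y%:F = x'%:F / y'%:F & coprime_elts x' y'].
Proof.
move=> mu_norm; have [m] := ubnP (mu y); elim: m => // m IHm in x y * => ltym y0.
have [[g [[x' xE] [y' yE] gu]]|no_g] := classic (exists g : R,
    [/\ divides g x, divides g y & g \isn't a GRing.unit]); last first.
  exists x, y; split=> // g gx gy; have [//|gu] := boolP (g \is a GRing.unit).
  by case: no_g; exists g.
have gy0 : g * y' != 0 by rewrite mulrC -yE.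
move: (gy0); rewrite mulf_eq0 negb_or => /andP[g0 y0'].
have [_ /(_ gu) lt_mu] := mu_norm _ _ gy0.
have {}lt_mu : (mu y' < m)%N.
  by apply: leq_trans lt_mu _; rewrite mulrC -yE -ltnS.
have [x1 [y1 [y10 E co]]] := IHm x' y' lt_mu y0'.
exists x1, y1; split=> //; rewrite -E xE yE !tofracM invfM mulrACA divff ?mulr1 //.
by rewrite tofrac_eq0.
Qed.

End ReducedFractions.

(** * Kernels of evaluations *)

Section Kernels.

Lemma divides_polyC (R : idomainType) (r : R) (p : {poly R}) :
  (forall i, divides r p`_i) -> divides r%:P p.
Proof.
elim/poly_ind: p => [|p c IHp] rp; first by exists 0; rewrite mul0r.
have [|p' ->] := IHp; first by move=> i; have := rp i.+1; rewrite coefD coefMX coefC addr0.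
have [c' cE] := rp 0%N; rewrite coefD coefMX coefC add0r /= in cE.
by exists (p' * 'X + c'%:P); rewrite cE polyCM; ring.
Qed.

Lemma map_poly_ker (R : idomainType) (K : idomainType) (psi : {rmorphism R -> K}) (r : R)
    (p : {poly R}) :
  (forall x, psi x = 0 -> divides r x) -> map_poly psi p = 0 -> divides r%:P p.
Proof. by move=> ker p0; apply: divides_polyC => i; apply: ker; rewrite -coef_map p0 coef0. Qed.

Lemma horner_ker (R : idomainType) (r : R) (p : {poly R}) :
  p.[r] = 0 -> divides ('X - r%:P) p.
Proof. by move/rootP/factor_theorem. Qed.

(* Synthetic division by [1 - r X], starting from the constant coefficient. *)
Lemma horner_inv_ker (R : idomainType) (r : R) (p : {poly R}) : r != 0 ->
  (map_poly (@FracField.tofrac R) p).[(r%:F)^-1] = 0 -> divides (1 - 'X * r%:P) p.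
Proof.
(* The coefficients of the power series p / (1 - rX). *)
move=> r0; pose h j := \sum_(i < j.+1) p`_i * r ^+ (j - i).
have hS j : h j.+1 = p`_j.+1 + r * h j.
  rewrite /h big_ord_recr /= subnn mulr1 addrC; congr (_ + _).
  rewrite mulr_sumr; apply: eq_bigr => i _.
  by rewrite subSn -1?ltnS // exprS mulrCA.
have [-> _|p0] := eqVneq p 0; first by exists 0; rewrite mul0r.
rewrite horner_coef size_map_inj_poly ?tofrac0 // => [hp0|u v /eqP]; last first.
  by rewrite tofrac_eq => /eqP.
set s := (size p).-1; have sizeE : size p = s.+1 by rewrite prednK // size_poly_gt0.
(* For s the degree of p, h s = r^s p(1/r); from there on the series is zero. *)
have hs0 : h s = 0.
  have hsE : (h s)%:F = r%:F ^+ s * 0.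
    rewrite -hp0 sizeE mulr_sumr rmorph_sum; apply: eq_bigr => i _.
    rewrite /= tofracM tofracXn coef_map mulrCA exprVn; congr (_ * _).
    by rewrite exprB ?unitfE ?tofrac_eq0 // -ltnS.
  by apply/eqP; rewrite -tofrac_eq0 hsE mulr0.
exists (\poly_(j < s) h j); apply/polyP => j.
rewrite mulrBr mulr1 mulrA coefB coefMC coefMX coef_poly.
case: j => [|j] /=; rewrite ?mul0r ?subr0.
  case: ltnP => [_|]; first by rewrite /h big_ord1 mulr1.
  by rewrite leqn0 => /eqP s0; move: hs0; rewrite s0 /h big_ord1 mulr1.
rewrite coef_poly; have [ltjs | leqsj] := ltnP j.+1 s.
  by rewrite (ltnW ltjs) hS; ring.
have [ltjs | lesj] := ltnP j s.
  have sE : s = j.+1 by apply/eqP; rewrite eqn_leq leqsj.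
  by move: hs0; rewrite sE hS => /eqP; rewrite addr_eq0 => /eqP ->; ring.
by rewrite nth_default ?sizeE //; ring.
Qed.

(** Division by the monic ['Phi_n] stays over Z; the remainder vanishes at z and has smaller degree
    than the minimal polynomial of z over Q, so it is zero. *)
Lemma Cyclotomic_ker n (z : algC) (p : {poly int}) : n.-primitive_root z ->
  (map_poly intr p).[z] = 0 -> divides 'Phi_n p.
Proof.
move=> prz; rewrite (Pdiv.IdomainMonic.divp_eq (Cyclotomic_monic n) p).
set r := (p %% 'Phi_n)%R; rewrite rmorphD rmorphM /= (Cintr_Cyclotomic prz).
rewrite hornerD hornerM (rootP (_ : root (cyclotomic z n) z)); last first.
  by rewrite root_cyclotomic.
rewrite mulr0 add0r => rz0.
suff -> : r = 0 by rewrite addr0; exists (p %/ 'Phi_n)%R.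
have [f [fE _] fP] := minCpolyP z.
have size_f : size f = size 'Phi_n.
  rewrite -(size_map_poly (ratr : {rmorphism rat -> algC})) -fE.
  by rewrite (minCpoly_cyclotomic prz) size_cyclotomic size_Cyclotomic.
have rQ : map_poly ratr (map_poly intr r : {poly rat}) = map_poly intr r :> {poly algC}.
  by rewrite -map_poly_comp; apply: eq_map_poly => b; rewrite /= ratr_int.
have : (f %| map_poly intr r)%R by rewrite -fP rQ; apply/rootP.
have size_r : size (map_poly intr r : {poly rat}) = size r.
  by apply: size_map_inj_poly => //; apply: intr_inj.
have [-> //|r0 /dvdp_leq] := eqVneq r 0.
rewrite -size_poly_eq0 size_r size_poly_eq0 r0 size_f => /(_ isT).
by rewrite leqNgt ltn_modp monic_neq0 ?Cyclotomic_monic.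
Qed.

End Kernels.

(** * Arithmetic of d, n and the summation bound *)

Section Exponents.
Local Open Scope nat_scope.

(** Here 2t + 1 = (n - 1)/d is the odd m with q^(1-n) = q^(-dm). *)
Lemma exponent_shape d n : 2 <= d -> ~~ odd d -> 0 < n -> n = d + 1 %[mod 2 * d] ->
  exists s t, [/\ 0 < s, d = 2 * s & n = (2 * t + 1) * d + 1].
Proof.
move=> hd evd hn hnd; exists d./2, (n %/ (2 * d)).
have dE : d = 2 * d./2 by rewrite -{1}(odd_double_half d) (negPf evd) -mul2n.
split=> //; first lia.
rewrite {1}(divn_eq n (2 * d)) hnd modn_small; last lia.
by ring.
Qed.

Section Shape.
Variables s t : nat.
Hypothesis s0 : 0 < s.
Let d := 2 * s.
Let n := (2 * t + 1) * d + 1.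
(** This is ((d-1)n + 1)/(2d), for which q^(-1) = q^(-2dN) when q^n = 1. *)
Let N := s * (2 * t + 1) - t.

Let NE : N + t = s * (2 * t + 1).
Proof. by rewrite subnK //; nia. Qed.

Lemma half_order : 2 * d * N = (d - 1) * n + 1.
Proof.
have : 2 * d * (N + t) + (n + 2 * d * t) = d * n + 1 + 2 * d * t + 2 * d * t by rewrite NE /n /d; nia.
have : 1 <= d by rewrite /d; lia.
by rewrite mulnBl; nia.
Qed.

Lemma upper_shape : upper d n = if s == 1 then 2 * t + 1 else N.
Proof.
rewrite /upper; have -> : (d == 2) = (s == 1) by rewrite /d; lia.
case: eqP => [s1|_]; first by rewrite /n /d s1 addnK muln1 mulnK.
have -> : d * n - n + 1 = N * (2 * d) by rewrite [RHS]mulnC half_order mulnBl mul1n.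
by rewrite mulnK // /d; lia.
Qed.

(** The sum has to reach both N and m = 2t + 1. For d = 2 one has N = t + 1 <= m, which is why
    [upper] treats that case separately. *)
Lemma upper_bounds :
  [/\ N <= upper d n, upper d n < n & 2 * t + 1 <= upper d n].
Proof. by rewrite upper_shape; case: eqP => s1; split; rewrite /n /d; nia. Qed.

Lemma odd_shape : odd n.
Proof. by rewrite /n /d addn1 /= !oddM andbF. Qed.

Lemma odd_double_succ : odd (2 * t + 1).
Proof. by rewrite addn1 /= oddM. Qed.

Lemma coprime_shape : coprime n (2 * d).
Proof.
rewrite coprimeMr coprimen2 odd_shape /= /n addn1 /coprime.
by rewrite -addn1 gcdnC gcdnMDl gcdn1.
Qed.

(** For the factors of (q^(d+2); q^(2d))_k. As n is odd and 1 mod d, a multiple kn = 1 + s + di has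
    k = 1 + s mod d. If s > 1 then k >= 1 + s, too large for i < N; if s = 1, n alone exceeds 1 + s
    + di. *)
Lemma denominator_exponent i : i < upper d n -> ~~ (n %| 2 + d + 2 * d * i).
Proof.
rewrite upper_shape => lti; have con2 : coprime n 2 by rewrite coprimen2 odd_shape.
have -> : 2 + d + 2 * d * i = 2 * (1 + s + d * i) by rewrite /d; ring.
rewrite Gauss_dvdr //; apply/negP => /dvdnP[k kE].
have : k = 1 + s %[mod d].
  rewrite -(modnMDl i (1 + s) d) -(modnMDl (k * (2 * t + 1)) k d); congr (_ %% _).
  by transitivity (1 + s + d * i); [rewrite kE /n; ring | ring].
move: lti; case: eqP => s1 lti kE'.
  have k0 : 0 < k by case: k kE {kE'} => //; lia.
  move: kE; rewrite /n /d s1; nia.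
have lek : 1 + s <= k.
  apply: leq_trans (leq_mod k d); rewrite kE' modn_small // /d; lia.
have : (1 + s) * n <= k * n by rewrite leq_mul2r lek orbT.
have di : d * i <= d * (s * (2 * t + 1)).
  by rewrite leq_mul2l -NE (leq_trans (ltnW lti)) ?leq_addr // orbT.
have dw : 0 < d * (2 * t + 1) by rewrite muln_gt0 addn1 andbT muln_gt0.
have -> : (1 + s) * n = d * (2 * t + 1) + d * (s * (2 * t + 1)) + (1 + s).
  by rewrite /n; ring.
by rewrite -kE; lia.
Qed.

End Shape.
End Exponents.

(** * Adjoining an indeterminate to a point *)

Section GenericPoint.

Definition const_frac (F : fieldType) : {rmorphism F -> {fraction {poly F}}} :=
  GRing.RMorphism.clone _ _ (@FracField.tofrac {poly F} \o polyC) _.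

Lemma const_frac_inj (F : fieldType) : injective (const_frac F).
Proof. exact: fmorph_inj. Qed.

Variables (R : idomainType) (F : fieldType) (f : {rmorphism R -> F}).

(** The target is again a field, so the construction iterates over a and e, each staying
    transcendental. *)
Definition adjoin : {rmorphism {poly R} -> {fraction {poly F}}} :=
  GRing.RMorphism.clone _ _ (@FracField.tofrac {poly F} \o map_poly f) _.

Lemma adjoinX : adjoin 'X = 'X%:F.
Proof. by rewrite /adjoin /= map_polyX. Qed.

Lemma adjoinC c : adjoin c%:P = const_frac F (f c).
Proof. by rewrite /adjoin /= map_polyC. Qed.

Lemma adjoin_ker r : (forall x, f x = 0 -> divides r x) ->
  forall p, adjoin p = 0 -> divides r%:P p.
Proof.
by move=> ker p /eqP; rewrite tofrac_eq0 => /eqP; apply: map_poly_ker.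
Qed.

(** At X = 0 the left-hand side vanishes and the right-hand side does not. *)
Lemma X_algebraic_neq (c c' : F) : c != 0 -> c' != 0 ->
  ('X)%:F * const_frac F c != const_frac F c'.
Proof.
move=> c0 c0'; rewrite /= -tofracM tofrac_eq; apply/eqP => /(congr1 (horner^~ 0)).
by rewrite !hornerE ?mul0r => /esym/eqP; rewrite (negPf c0').
Qed.

End GenericPoint.

(** * The sum is defined and zero at the points *)

Section Points.
Variables (d n : nat).
Hypotheses (hd2 : (2 <= d)%N) (hdeven : ~~ odd d) (hn : (0 < n)%N)
  (hnd : (n = d + 1 %[mod 2 * d])%N).

Let S : {fraction Zqae} :=
  \sum_(0 <= k < (upper d n).+1) summand (vq%:F) (va%:F) (ve%:F) d k.

Lemma specialises_summand_sum (K : fieldType) (phi : {rmorphism Zqae -> K}) :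
    phi vq != 0 -> phi va != 0 -> phi ve != 0 -> phi vq != 1 ->
    (forall k, (k <= upper d n)%N -> summand_den (phi vq) (phi va) (phi ve) d k != 0) /\
    \sum_(k < (upper d n).+1) summand (phi vq) (phi va) (phi ve) d k = 0 ->
  specialises phi S 0.
Proof.
move=> q0 a0 e0 q1 [den0 <-]; rewrite /S big_mkord; apply: specialises_sum => k _.
apply: specialises_summand => //; first by rewrite subr_eq0 eq_sym.
by rewrite den0 // -ltnS.
Qed.

Variables (F : fieldType) (psi : {rmorphism {poly {poly int}} -> F}).
Hypothesis q0 : psi 'X%:P != 0.

Lemma adjoin_ve_neq u v : adjoin psi ve * adjoin psi vq ^+ u != adjoin psi vq ^+ v.
Proof.
rewrite /ve /vq adjoinX adjoinC -!(rmorphXn (const_frac F)).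
by apply: X_algebraic_neq; rewrite expf_neq0.
Qed.

Lemma adjoin_ve_neq0 : adjoin psi ve != 0.
Proof. by rewrite /ve adjoinX tofrac_eq0 polyX_eq0. Qed.

Lemma adjoin_vq_neq0 : adjoin psi vq != 0.
Proof. by rewrite /vq adjoinC fmorph_eq0. Qed.

Lemma generic_point : (forall u, (0 < u)%N -> psi 'X%:P ^+ u != 1) ->
  (psi 'X = psi 'X%:P ^+ n) \/ (psi 'X = (psi 'X%:P ^+ n)^-1) ->
  specialises (adjoin psi) S 0.
Proof.
move=> q_neq1 aE; have [s [t [s0 dE nE]]] := exponent_shape hd2 hdeven hn hnd.
have [_ _ lemM] := upper_bounds t s0; rewrite -dE -nE in lemM.
have q_neq1' u : (0 < u)%N -> adjoin psi vq ^+ u != 1.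
  by move=> u0; rewrite /vq adjoinC -(rmorphXn (const_frac F)) fmorph_eq1 q_neq1.
have aE' : adjoin psi va = adjoin psi vq ^+ n \/ adjoin psi va = (adjoin psi vq ^+ n)^-1.
  by rewrite /va /vq !adjoinC -(rmorphXn (const_frac F)) -fmorphV; case: aE => ->; [left|right].
have oddn : odd n by rewrite nE dE odd_shape.
have nE' : n = (d * (2 * t + 1)).+1 by rewrite nE mulnC addn1.
have [den0 sum0] := generic_summand_sum hd2 hdeven oddn q_neq1' adjoin_vq_neq0
  nE' (odd_double_succ t) lemM adjoin_ve_neq adjoin_ve_neq0 aE'.
apply: specialises_summand_sum => //.
- exact: adjoin_vq_neq0.
- by case: aE' => ->; rewrite ?invr_eq0 expf_neq0 ?adjoin_vq_neq0.
- exact: adjoin_ve_neq0.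
- exact: (q_neq1' 1).
Qed.

End Points.

Lemma cyclotomic_point (d n : nat) (F : fieldType) (f : {rmorphism {poly int} -> F}) :
    (2 <= d)%N -> ~~ odd d -> (0 < n)%N -> (n = d + 1 %[mod 2 * d])%N ->
    n.-primitive_root (f 'X) ->
  specialises (adjoin (adjoin f))
    (\sum_(0 <= k < (upper d n).+1) summand (vq%:F) (va%:F) (ve%:F) d k) 0.
Proof.
move=> hd2 hdeven hn hnd prx; have [s [t [s0 dE nE]]] := exponent_shape hd2 hdeven hn hnd.
have [leNM ltMn _] := upper_bounds t s0; rewrite -dE -nE in leNM ltMn.
have den := denominator_exponent (t := t) s0; rewrite -dE -nE in den.
have NE := half_order t s0; rewrite -dE -nE in NE.
have con : coprime n (2 * d) by rewrite nE {1}dE dE coprime_shape.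
have x0 : f 'X != 0.
  apply/eqP => x0; move: (prim_expr_order prx).
  by rewrite x0 expr0n gtn_eqF // => /esym/eqP; rewrite oner_eq0.
have q0 : adjoin f 'X%:P != 0 by rewrite adjoinC fmorph_eq0.
have prq : n.-primitive_root (adjoin (adjoin f) vq).
  by rewrite /vq !adjoinC !fmorph_primitive_root.
have ha u v : adjoin (adjoin f) va * adjoin (adjoin f) vq ^+ u != adjoin (adjoin f) vq ^+ v.
  rewrite /va /vq !adjoinC adjoinX -!(rmorphXn (const_frac _)) -(rmorphM (const_frac _)).
  rewrite (inj_eq (@const_frac_inj _)).
  by apply: X_algebraic_neq; rewrite expf_neq0.
have a0 : adjoin (adjoin f) va != 0.
  by rewrite /va adjoinC fmorph_eq0 adjoinX tofrac_eq0 polyX_eq0.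
(* q = 1 would force n = 1, but n > d. *)
have vq1 : adjoin (adjoin f) vq != 1.
  by rewrite -[X in X != _]expr1 -(prim_order_dvd prq) dvdn1 nE addn1 eqSS muln_eq0
    addn1 /= -lt0n (ltnW hd2).
have sum0 := cyclotomic_summand_sum hd2 prq con NE (introT andP (conj leNM ltMn)) den ha
  (adjoin_ve_neq q0) a0 (adjoin_ve_neq0 _).
exact: (specialises_summand_sum (adjoin_vq_neq0 q0) a0 (adjoin_ve_neq0 _) vq1 sum0).
Qed.

(** * The evaluations a = q^n, a = q^(-n) and q = z, and the conclusion *)

Definition eval_Xn n : {rmorphism {poly {poly int}} -> {fraction {poly int}}} :=
  GRing.RMorphism.clone _ _ (@FracField.tofrac {poly int} \o horner_eval ('X^n : {poly int})) _.

Definition eval_Xn_inv n : {rmorphism {poly {poly int}} -> {fraction {poly int}}} :=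
  GRing.RMorphism.clone _ _ (horner_eval (('X^n : {poly int})%:F)^-1
    \o map_poly (@FracField.tofrac {poly int})) _.

Definition eval_root (z : algC) : {rmorphism {poly int} -> algC} :=
  GRing.RMorphism.clone _ _ (horner_eval z \o map_poly intr) _.

Lemma eval_XnC n c : eval_Xn n c%:P = c%:F.
Proof. by rewrite /eval_Xn /= /horner_eval hornerC. Qed.

Lemma eval_XnX n : eval_Xn n 'X = ('X^n)%:F.
Proof. by rewrite /eval_Xn /= /horner_eval hornerX. Qed.

Lemma eval_Xn_invC n c : eval_Xn_inv n c%:P = c%:F.
Proof. by rewrite /eval_Xn_inv /= /horner_eval map_polyC hornerC. Qed.

Lemma eval_Xn_invX n : eval_Xn_inv n 'X = (('X^n)%:F)^-1.
Proof. by rewrite /eval_Xn_inv /= /horner_eval map_polyX hornerX. Qed.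

Lemma eval_rootX z : eval_root z 'X = z.
Proof. by rewrite /eval_root /= /horner_eval map_polyX hornerX. Qed.

Lemma fracX_neq1 u : (0 < u)%N -> ('X : {poly int})%:F ^+ u != 1.
Proof.
move=> u0; rewrite -tofracXn -tofrac1 tofrac_eq.
apply/eqP => /(congr1 (fun p : {poly int} => size p)).
by rewrite size_polyXn size_poly1; case: u u0.
Qed.

Lemma eval_root_ker n z : n.-primitive_root z ->
  forall p, adjoin (adjoin (eval_root z)) p = 0 -> divides ('Phi_n)%:P%:P p.
Proof. by move=> prz; do 2!apply: adjoin_ker => ?; apply: Cyclotomic_ker. Qed.

Lemma eval_Xn_ker n p : adjoin (eval_Xn n) p = 0 -> divides (va - vq ^+ n) p.
Proof.
rewrite /va /vq -!rmorphXn -rmorphB; apply: adjoin_ker => x /eqP.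
by rewrite tofrac_eq0 => /eqP; apply: horner_ker.
Qed.

Lemma eval_Xn_inv_ker n p : adjoin (eval_Xn_inv n) p = 0 -> divides (1 - va * vq ^+ n) p.
Proof.
rewrite /va /vq -!rmorphXn -rmorphM -(rmorph1 polyC) -rmorphB.
by apply: adjoin_ker => x; apply: horner_inv_ker; rewrite monic_neq0 ?monicXn.
Qed.

Theorem theorem3p1 (d n : nat)
    (hd2 : (2 <= d)%N) (hdeven : ~~ odd d)
    (hn : (0 < n)%N) (hnd : (n = d + 1 %[mod 2 * d])%N) :
  frac_congr (modulus n)
    (\sum_(0 <= k < (upper d n).+1) summand (vq%:F) (va%:F) (ve%:F) d k) 0.
Proof.
have [z prz] := C_prim_root_exists hn.
have at_root : specialises (adjoin (adjoin (eval_root z)))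
    (\sum_(0 <= k < (upper d n).+1) summand (vq%:F) (va%:F) (ve%:F) d k) 0.
  by apply: cyclotomic_point; rewrite ?eval_rootX.
have at_Xn : specialises (adjoin (eval_Xn n))
    (\sum_(0 <= k < (upper d n).+1) summand (vq%:F) (va%:F) (ve%:F) d k) 0.
  apply: generic_point => //; rewrite eval_XnC ?tofrac_eq0 ?polyX_eq0 //.
    exact: fracX_neq1.
  by left; rewrite eval_XnX tofracXn.
have at_Xn_inv : specialises (adjoin (eval_Xn_inv n))
    (\sum_(0 <= k < (upper d n).+1) summand (vq%:F) (va%:F) (ve%:F) d k) 0.
  apply: generic_point => //; rewrite eval_Xn_invC ?tofrac_eq0 ?polyX_eq0 //.
    exact: fracX_neq1.
  by right; rewrite eval_Xn_invX tofracXn.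
(* One point supplies the sum as a fraction over Z[q, a, e]; its reduced form then serves all
   three. *)
have [x [y [y0 sE _]]] := at_root.
have {}y0 : y != 0 by apply: contraNneq y0 => ->; rewrite rmorph0.
have norm := divisor_norm_poly (divisor_norm_poly (divisor_norm_poly divisor_norm_int)).
have [N [D [D0 ND co]]] := reduced_fraction x norm y0.
rewrite sE ND in at_root at_Xn at_Xn_inv *.
have {at_root} [N1 NE1] := eval_root_ker prz (specialises_eq0 D0 at_root).
have Phi0 : 'Phi_n != 0 by rewrite monic_neq0 ?Cyclotomic_monic.
(* The evaluation a = q^(-n) has values in a field and does not kill ['Phi_n], so it kills the
   cofactor N1; the next factor is split off likewise. *)
have := specialises_eq0 D0 at_Xn_inv; rewrite {1}NE1 rmorphM => /eqP.
rewrite mulf_eq0 => /orP[/eqP/eval_Xn_inv_ker[N2 NE2]|]; last first.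
  by rewrite adjoinC eval_Xn_invC fmorph_eq0 tofrac_eq0 (negPf Phi0).
have := specialises_eq0 D0 at_Xn; rewrite {1}NE1 NE2 !rmorphM => /eqP.
rewrite !mulf_eq0 => /orP[/orP[/eqP/eval_Xn_ker[N3 NE3]|]|].
- have dvd : divides (modulus n) N.
    by exists N3; rewrite NE1 NE2 NE3 /modulus; ring.
  exists N, D; split=> //; first by rewrite subr0.
  (* The modulus divides N, so a common divisor of D and the modulus divides N as well. *)
  move=> g gD gP; apply: co => //.
  by case: gP dvd => w -> [w' ->]; exists (w' * w); rewrite mulrA.
(* At a = q^n the factor 1 - a q^n becomes 1 - q^(2n), which is nonzero. *)
- rewrite rmorphB rmorph1 rmorphM rmorphXn /va /vq !adjoinC eval_XnX eval_XnC.
  rewrite tofracXn -(rmorphXn (const_frac _)) -(rmorphM (const_frac _)) -exprD.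
  by rewrite subr_eq0 eq_sym fmorph_eq1 (negPf (fracX_neq1 _)) // addn_gt0 hn.
- by rewrite adjoinC eval_XnC fmorph_eq0 tofrac_eq0 (negPf Phi0).
Qed.
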